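(* Let $\mathcal{S}$ be a pseudo-regular subspace of a Krein space $\mathcal{H}$ with fundamental symmetry $J$. The group $\mathcal{U}_{\mathcal{S}}$ acts transitively on $\mathcal{Q}_{\mathcal{S}}$ by $U\cdot Q=UQU^{\#}$.
   Context: $(\mathcal{H},\langle\cdot,\cdot\rangle)$ is a complex separable Hilbert space, $L(\mathcal{H})$ its algebra of bounded operators, $J\in L(\mathcal{H})$ a fixed symmetry ($J=J^*=J^{-1}$), $[f,g]=\langle Jf,g\rangle$, and $T^{\#}=JT^*J$. For a subspace $\mathcal{S}$, $\mathcal{S}^{[\perp]}=\{f:[f,g]=0\ \forall g\in\mathcal{S}\}$ and $\mathcal{S}^{\circ}=\mathcal{S}\cap\mathcal{S}^{[\perp]}$; $[\dot{+}]$ is $J$-orthogonal direct sum. A closed subspace $\mathcal{M}$ is regular if $\mathcal{M}[\dot{+}]\mathcal{M}^{[\perp]}=\mathcal{H}$. A closed subspace $\mathcal{S}$ is pseudo-regular if $\mathcal{S}=\mathcal{S}^{\circ}[\dot{+}]\mathcal{M}$ for some regular $\mathcal{M}$. $\mathcal{Q}_{\mathcal{S}}=\{Q\in L(\mathcal{H}):Q^2=Q,\ QQ^{\#}=Q^{\#}Q,\ R(Q)=\mathcal{S}\}$ is the set of $J$-normal projections with range $\mathcal{S}$, and $\mathcal{U}_{\mathcal{S}}=\{U\in L(\mathcal{H}):UU^{\#}=U^{\#}U=I,\ U(\mathcal{S})=\mathcal{S}\}$. *)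

(* Defs.v *)
From HB Require Import structures.
From mathcomp Require Import all_boot all_order all_algebra.
From mathcomp Require Export complex.
From mathcomp Require Import all_classical all_reals all_analysis.
Export numFieldNormedType.Exports.

Set Implicit Arguments.
Unset Strict Implicit.
Unset Printing Implicit Defensive.

Import Order.TTheory GRing.Theory Num.Theory.
Local Open Scope classical_set_scope.
Local Open Scope ring_scope.

Definition separable_space (T : topologicalType) : Prop :=
  exists D : set T, countable D /\ dense D.

(* Concrete groups of transformations of T, with composition as product, and
   their actions on a set X of points of Y. *)
Section GroupActions.
Variables (T Y : Type).
Implicit Types (G : set (T -> T)) (X : set Y) (act : (T -> T) -> Y -> Y).

Definition transformation_group G : Prop :=
  [/\ G id,
      forall g h, G g -> G h -> G (g \o h) &
      forall g, G g -> exists h, [/\ G h, g \o h = id & h \o g = id]].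

Definition group_action_on G X act : Prop :=
  [/\ forall g x, G g -> X x -> X (act g x),
      forall x, X x -> act id x = x &
      forall g h x, G g -> G h -> X x -> act (g \o h) x = act g (act h x)].

(* A transitive action has exactly one orbit, so X is nonempty (the same
   convention as [transitive G, on X | to] for finite groups). *)
Definition transitive_action_on G X act : Prop :=
  [/\ group_action_on G X act, X !=set0 &
      forall x y, X x -> X y -> exists2 g, G g & act g x = y].

End GroupActions.

Section HilbertSpace.
Variables (R : realType) (H : completeNormedModType R[i]).
Variable dot : {dot H for Num.conj}.
Implicit Types (T Q U : H -> H) (S A B M : set H).

(* The norm of H is the one induced by the inner product; since H is complete,
   (H, dot) is then a complex Hilbert space. *)
Definition norm_from_dot : Prop := forall x : H, `|x| ^+ 2 = dot x x.

Definition bounded_operator T : Prop :=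
  linear T /\ exists M : R[i], forall x, `|T x| <= M * `|x|.

(* adjoint T g is the Riesz vector h of the functional f |-> <T f, g>; it is
   unique, and it exists for every g when T is bounded and H is Hilbert.  The
   default value 0 is irrelevant for bounded operators. *)
Definition adjoint T : H -> H :=
  fun g => xget 0 [set h | forall f, dot (T f) g = dot f h].

Definition closed_subspace S : Prop :=
  submod_closed (mem S) /\ closed S.

Definition symmetry (J : H -> H) : Prop :=
  [/\ bounded_operator J, adjoint J = J & J \o J = id].

Section Krein.
Variable J : H -> H.

Definition krein f g : R[i] := dot (J f) g.

Definition Jadjoint T : H -> H := J \o adjoint T \o J.

Definition Jorth S : set H := [set f | forall g, S g -> krein f g = 0].

Definition isotropic_part S : set H := S `&` Jorth S.

(* S = A [+] B, a direct sum of J-orthogonal subspaces. *)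
Definition Jorth_direct_sum S A B : Prop :=
  [/\ S = [set a + b | a in A & b in B],
      A `&` B = [set 0] &
      forall a b, A a -> B b -> krein a b = 0].

Definition regular_subspace M : Prop :=
  closed_subspace M /\ Jorth_direct_sum setT M (Jorth M).

Definition pseudo_regular_subspace S : Prop :=
  closed_subspace S /\
  exists2 M, regular_subspace M & Jorth_direct_sum S (isotropic_part S) M.

Definition Jnormal_projections S : set (H -> H) :=
  [set Q | [/\ bounded_operator Q, Q \o Q = Q,
               Q \o Jadjoint Q = Jadjoint Q \o Q & range Q = S]].

Definition Junitaries_preserving S : set (H -> H) :=
  [set U | [/\ bounded_operator U, U \o Jadjoint U = id,
               Jadjoint U \o U = id & U @` S = S]].

Definition Jconjugation U Q : H -> H := U \o Q \o Jadjoint U.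

End Krein.
End HilbertSpace.

(* Main.v *)
Require Import Defs.
From HB Require Import structures.
From mathcomp Require Import all_boot all_order all_algebra.
From mathcomp Require Import all_classical all_reals all_analysis.
From mathcomp Require Import ring lra.

(** Why the action is transitive.  Write Q# for the J-adjoint.  A J-normal
    projection Q commutes with Q#, so the four products of Q or 1 - Q with Q#
    or 1 - Q# are mutually orthogonal idempotents of sum 1.  They decompose H
    into a regular complement of the isotropic part N of S inside S, N itself,
    a neutral space in duality with N, and a regular rest; the involution #
    fixes the first and last idempotents and swaps the two neutral ones.  If P
    is another J-normal projection with the same range S, then PQ = Q and
    QP = P.  From these two identities alone each block of P, followed by the
    corresponding block of Q, followed by the block of P, is the block of P
    ([normal_block_compress]).  So the sum U of the products (block of Q)
    (block of P) has as inverse the sum of the products in the other order.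
    As # permutes the four blocks of P and of Q in the same way, this inverse
    is U#, and U carries P to Q ([normal_idempotents_conjugate]).  The argument
    is an identity in an arbitrary ring with involution.

    Why there is a J-normal projection onto S.  Let S = N [+] M with M regular.
    The projection E onto M along its J-orthogonal complement is J-selfadjoint,
    and P(1 - E), where P is the orthogonal projection onto N, is a projection
    p onto N with Ep = pE = 0 and p#p = 0, because N is neutral.  Replacing p
    by p - pp#/2 kills pp# as well without changing the range, and E plus the
    corrected p is J-normal ([normal_idempotent_extend]).

    What is left is that bounded operators on H form a ring on which # is an
    involution, and that E and P are bounded.  The first point is the Riesz
    representation theorem, which follows from the projection theorem; the
    second is the Hellinger-Toeplitz theorem, as both projections are symmetric
    for a nondegenerate form. *)

Set Implicit Arguments.
Unset Strict Implicit.
Unset Printing Implicit Defensive.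

Import Order.TTheory GRing.Theory Num.Theory Normc.
Local Open Scope classical_set_scope.
Local Open Scope ring_scope.

(** * Normal idempotents in a ring with involution *)

Section IdempotentFamilies.
Variables (A : pzRingType) (I : finType).
Implicit Types e f : I -> A.

Definition idempotent_resolution e :=
  (forall i j, e i * e j = if i == j then e i else 0) /\ \sum_i e i = 1.

Definition transfer e f := \sum_i f i * e i.

(** By orthogonality only the products e i * f i * f i * e i survive, and they
    reduce to e i: the element f i loses no information on the range of
    e i, and e i recovers it. *)
Lemma transferK e f : idempotent_resolution e -> idempotent_resolution f ->
  (forall i, e i * f i * e i = e i) -> transfer f e * transfer e f = 1.
Proof.
move=> [_ e1] [fo _] efe; rewrite -[RHS]e1 mulr_suml; apply: eq_bigr => i _.
rewrite mulr_sumr (bigD1 i)//= big1 ?addr0 => [|j /negPf ji].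
  by rewrite mulrA -[e i * f i * _]mulrA fo eqxx efe.
by rewrite mulrA -[e i * f i * _]mulrA fo eq_sym ji mulr0 mul0r.
Qed.

End IdempotentFamilies.

Section InvolutiveRing.
Variables (A : pzRingType) (star : A -> A).
Hypothesis starD : {morph star : a b / a + b}.
Hypothesis starM : forall a b, star (a * b) = star b * star a.
Hypothesis starK : involutive star.

Lemma star0 : star 0 = 0.
Proof. by apply: (addrI (star 0)); rewrite -starD !addr0. Qed.

Lemma starN a : star (- a) = - star a.
Proof. by apply: (addrI (star a)); rewrite -starD !subrr star0. Qed.

Lemma star1 : star 1 = 1.
Proof. by rewrite -[LHS]mul1r -{1}[1]starK -starM mul1r starK. Qed.

Definition unitary u := u * star u = 1 /\ star u * u = 1.

Lemma unitary1 : unitary 1.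
Proof. by rewrite /unitary star1 mul1r. Qed.

Lemma unitaryM u v : unitary u -> unitary v -> unitary (u * v).
Proof.
move=> [u1 u2] [v1 v2]; split; rewrite starM.
  by rewrite mulrA -(mulrA u) v1 mulr1.
by rewrite mulrA -(mulrA (star v)) u2 mulr1.
Qed.

Lemma unitary_star u : unitary u -> unitary (star u).
Proof. by case=> u1 u2; split; rewrite starK. Qed.

Definition normal_idempotent (q : A) := q * q = q /\ q * star q = star q * q.

Lemma normal_idempotent_conj u q :
  unitary u -> normal_idempotent q -> normal_idempotent (u * q * star u).
Proof.
move=> [_ u2] [qq qC].
have conjM a b : u * a * star u * (u * b * star u) = u * (a * b) * star u.
  by rewrite -!mulrA (mulrA (star u)) u2 mul1r.
rewrite /normal_idempotent.
have -> : star (u * q * star u) = u * star q * star u.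
  by rewrite !starM starK mulrA.
by split; rewrite !conjM ?qq ?qC.
Qed.

(** The idempotent q and its complement, indexed by a boolean so that the four
    blocks below form one family. *)
Definition idem_part (q : A) (b : bool) : A := if b then q else 1 - q.

(** For a J-normal projection onto S, the blocks (true, true), (true, false),
    (false, true) and (false, false) project onto a regular complement of the
    isotropic part in S, the isotropic part, a neutral space dual to it, and
    the rest. *)
Definition normal_block (q : A) (i : bool * bool) :=
  idem_part q i.1 * star (idem_part q i.2).

Lemma idem_partM q b c : q * q = q ->
  idem_part q b * idem_part q c = if b == c then idem_part q b else 0.
Proof.
by move=> qq; case: b c => [] [] /=;
  rewrite ?mulrBl ?mulrBr ?mul1r ?mulr1 ?qq ?subrr ?subr0.
Qed.

Lemma idem_part_comm q b c : normal_idempotent q ->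
  star (idem_part q c) * idem_part q b = idem_part q b * star (idem_part q c).
Proof.
case=> _ /esym cq; case: b c => [] [] //=; rewrite ?starD ?starN ?star1.
- by rewrite mulrBl mulrBr mul1r mulr1 cq.
- by rewrite mulrBl mulrBr mul1r mulr1 cq.
- by apply: (commrB (commr1 _)); apply/commr_sym/(commrB (commr1 _))/commr_sym.
Qed.

Lemma normal_block_resolution q :
  normal_idempotent q -> idempotent_resolution (normal_block q).
Proof.
move=> nq; have [qq _] := nq; split=> [[b c] [b' c']|].
  rewrite /normal_block /= mulrA -(mulrA (idem_part q b)) idem_part_comm //.
  rewrite mulrA -mulrA -starM !idem_partM // xpair_eqE (eq_sym c').
  case: eqP => [->|_]; last by rewrite mul0r.
  by case: eqP => [->//|_]; rewrite star0 mulr0.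
rewrite -(pair_bigA _ (fun b c => normal_block q (b, c))) /=.
by rewrite !big_bool /normal_block /= -!mulrDr -!starD [q + _]addrC subrK
  star1 !mulr1 addrC subrK.
Qed.

Lemma star_normal_block q b c :
  star (normal_block q (b, c)) = normal_block q (c, b).
Proof. by rewrite /normal_block starM starK. Qed.

Section SameRange.
Variables p q : A.
Hypotheses (np : normal_idempotent p) (nq : normal_idempotent q).
Hypotheses (pq : p * q = q) (qp : q * p = p).

Let x := idem_part p.
Let y := idem_part q.
Let xyF : x false * y false = x false.
Proof. by rewrite /x /y /= mulrBl mul1r mulrBr mulr1 pq opprB addrA subrK. Qed.
Let yxF : y false * x false = y false.
Proof. by rewrite /x /y /= mulrBl mul1r mulrBr mulr1 qp opprB addrA subrK. Qed.

(** The complementary idempotents absorb each other in the opposite order, as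
    1 - p and 1 - q have the same kernel.  Since each part commutes with the
    star of each part of the same element, the factors of a block can be
    exchanged until such an absorption applies. *)
Lemma normal_block_compress i :
  normal_block p i * normal_block q i * normal_block p i = normal_block p i.
Proof.
have xC b c : star (x c) * x b = x b * star (x c) by exact: idem_part_comm.
have yC b c : star (y c) * y b = y b * star (y c) by exact: idem_part_comm.
have xxF : x false * x false = x false by exact: (idem_partM false false np.1).
have eE b c : normal_block p (b, c) = x b * star (x c) by [].
have fE b c : normal_block q (b, c) = y b * star (y c) by [].
have xyT : x true * y true = y true by exact: pq.
have yxT : y true * x true = x true by exact: qp.
have xT : x true * x true = x true by exact: np.1.
(* This mixed block also gives the other one, which is its image by star. *)
have tf : normal_block p (true, false) * normal_block q (true, false)
    * normal_block p (true, false) = normal_block p (true, false).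
  rewrite eE fE -{1}xC -!mulrA (mulrA (x true) (y true)) xyT (mulrA (y true)).
  rewrite -yC -mulrA (mulrA (y true)) yxT mulrA -starM yxF.
  by rewrite -xC mulrA -starM xyF.
case: i => [[] []] //.
- rewrite eE fE -{1}xC -!mulrA (mulrA (x true) (y true)) xyT (mulrA (y true)).
  rewrite -yC -mulrA (mulrA (y true)) yxT mulrA -starM yxT.
  by rewrite -xC mulrA -starM xT.
- by rewrite -(star_normal_block p true false)
    -(star_normal_block q true false) -!starM mulrA tf.
- rewrite eE fE -{1}xC -!mulrA (mulrA (x false) (y false)) xyF.
  rewrite -xC [_ * (star _ * x false)]mulrA -starM xyF.
  by rewrite xC (mulrA (x false)) xxF -xC mulrA -starM xxF xC.
Qed.

End SameRange.

Section Conjugation.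
Variables p q : A.
Hypotheses (np : normal_idempotent p) (nq : normal_idempotent q).
Hypotheses (pq : p * q = q) (qp : q * p = p).

Let u := transfer (normal_block p) (normal_block q).

Lemma star_sum (J : finType) (F : J -> A) :
  star (\sum_j F j) = \sum_j star (F j).
Proof. exact: (big_morph star starD star0). Qed.

(** The involution swaps the two mixed blocks of p and of q simultaneously, so
    it reverses the direction of the transfer. *)
Lemma star_transfer :
  star u = transfer (normal_block q) (normal_block p).
Proof.
have swapK : involutive (fun i : bool * bool => (i.2, i.1)) by case.
rewrite /u /transfer star_sum (reindex_inj (inv_inj swapK)) /=.
by apply: eq_bigr => -[b c] _; rewrite starM !star_normal_block.
Qed.

(** The transfer intertwines p and q because each of them is the sum of its own
    blocks with first index true. *)
Lemma normal_idempotents_conjugate :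
  exists2 v, unitary v & v * p = q * v.
Proof.
have [ep eq] := (normal_block_resolution np, normal_block_resolution nq).
exists u.
  rewrite /unitary star_transfer; split.
    exact: (transferK eq ep (normal_block_compress nq np qp pq)).
  exact: (transferK ep eq (normal_block_compress np nq pq qp)).
rewrite /u /transfer mulr_suml mulr_sumr; apply: eq_bigr => -[b c] _.
rewrite -[LHS]mulrA [RHS]mulrA.
have -> : normal_block p (b, c) * p = if b then normal_block p (b, c) else 0.
  rewrite /normal_block /= -idem_part_comm // -mulrA.
  rewrite -[p in X in _ * X]/(idem_part p true) idem_partM ?np.1//.
  by case: b; rewrite ?mulr0.
have -> : q * normal_block q (b, c) = if b then normal_block q (b, c) else 0.
  rewrite /normal_block /= mulrA.
  rewrite -[q in X in X * _]/(idem_part q true) idem_partM ?nq.1//.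
  by case: b; rewrite ?mul0r.
by case: b; rewrite // mulr0 mul0r.
Qed.

End Conjugation.

Section Extension.
Variables e p h : A.
Hypotheses (ee : e * e = e) (se : star e = e).
Hypotheses (pp : p * p = p) (spp : star p * p = 0).
Hypotheses (ep : e * p = 0) (pe : p * e = 0).
Hypotheses (hC : forall a, h * a = a * h) (h2 : h + h = 1).

Let sh : star h = h.
Proof.
have shC a : star h * a = a * star h by rewrite -[a]starK -!starM hC.
have sh2 : star h + star h = 1 by rewrite -starD h2 star1.
by rewrite -[LHS]mulr1 -h2 mulrDr -mulrDl sh2 mul1r.
Qed.

(** Here h is one half.  The element k = h * (p * star p) is fixed by star and
    has square zero, and r = p - k satisfies both r * star r = 0 and
    star r * r = 0, while having the same right ideal as p. *)
Lemma normal_idempotent_extend :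
  exists q, [/\ normal_idempotent q, q * e = e, q * p = p &
                exists a, q = e + p * a].
Proof.
have es : e * star p = 0 by rewrite -se -starM pe star0.
have se0 : star p * e = 0 by rewrite -se -starM ep star0.
have sps : star p * star p = star p by rewrite -starM pp.
pose k := h * (p * star p); pose r := p - k.
have sk : star k = k by rewrite /k !starM starK sh hC.
have pk : p * k = k by rewrite /k mulrA -hC -mulrA (mulrA p) pp.
have kp : k * p = 0 by rewrite /k -!mulrA spp !mulr0.
have ks : k * star p = k by rewrite /k -!mulrA sps.
have sk0 : star p * k = 0.
  by rewrite /k mulrA -hC -mulrA (mulrA (star p)) spp mul0r mulr0.
have kk : k * k = 0.
  by rewrite {2}/k mulrA -hC -mulrA [k * _]mulrA kp mul0r mulr0.
have k2 : k + k = p * star p by rewrite /k -mulrDl h2 mul1r.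
have rr : r * r = r by rewrite /r mulrBl !mulrBr pp pk kp kk subrr subr0.
have sr : star r = star p - k by rewrite /r starD starN sk.
have rsr : r * star r = 0.
  by rewrite sr /r mulrBl !mulrBr pk ks kk -k2 addrK subr0 subrr.
have srr : star r * r = 0.
  by rewrite sr /r mulrBl !mulrBr spp sk0 kp kk !subr0.
have ek : e * k = 0 by rewrite /k mulrA -hC -mulrA (mulrA e) ep mul0r mulr0.
have ke : k * e = 0 by rewrite /k -!mulrA se0 !mulr0.
have er : e * r = 0 by rewrite /r mulrBr ep ek subr0.
have re : r * e = 0 by rewrite /r mulrBl pe ke subr0.
have esr : e * star r = 0 by rewrite sr mulrBr es ek subr0.
have sre : star r * e = 0 by rewrite sr mulrBl se0 ke subr0.
have pr : p * (1 - k) = r by rewrite mulrBr mulr1 pk.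
have rp : r * p = p by rewrite /r mulrBl pp kp subr0.
clearbody r; exists (e + r); split.
- split; first by rewrite mulrDl !mulrDr ee er re rr addr0 add0r.
  by rewrite starD se !mulrDl !mulrDr er re esr sre rsr srr.
- by rewrite mulrDl ee re addr0.
- by rewrite mulrDl ep add0r rp.
- by exists (1 - k); rewrite pr.
Qed.

End Extension.
End InvolutiveRing.

(** * The real-valued norm *)

Section Modulus.
Variable R : realType.
Implicit Types a z : R[i].

Lemma norm_normc z : `|z| = (normc z)%:C%C.
Proof. by []. Qed.

Lemma normc_ge0 z : 0 <= normc z.
Proof. by rewrite -ler0c -norm_normc. Qed.

Lemma normc_sqr z : (normc z ^+ 2)%:C%C = z * Num.conj z.
Proof. by rewrite rmorphXn /= -norm_normc normCK. Qed.

Lemma normcD a z : normc (a + z) <= normc a + normc z.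
Proof. exact: le_normcD. Qed.

Lemma normcN z : normc (- z) = normc z.
Proof. by apply: complexI; rewrite -!norm_normc normrN. Qed.

Lemma normcJ z : normc (Num.conj z) = normc z.
Proof. by apply: complexI; rewrite -!norm_normc norm_conjC. Qed.

Lemma normc_real (r : R) : 0 <= r -> normc r%:C%C = r.
Proof. by move=> r0; apply: complexI; rewrite -norm_normc ger0_norm ?ler0c. Qed.

Lemma normc_le0 z : normc z <= 0 -> z = 0.
Proof.
by move=> z0; apply: eq0_normc; apply/eqP; rewrite eq_le z0 normc_ge0.
Qed.

End Modulus.

Section RealNorm.
Variables (R : realType) (H : completeNormedModType R[i]).
Implicit Types x y z : H.

(** The norm of H takes its values in the partially ordered field R[i]; its
    real part carries the same information and lives in a totally ordered,
    archimedean and complete field. *)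
Definition rnorm x : R := complex.Re `|x|.

Lemma normE x : `|x| = (rnorm x)%:C%C.
Proof. by rewrite /rnorm RRe_real // ger0_real. Qed.

Lemma rnorm_ge0 x : 0 <= rnorm x.
Proof. by rewrite -ler0c -normE. Qed.

Lemma rnormD x y : rnorm (x + y) <= rnorm x + rnorm y.
Proof. by rewrite -lecR rmorphD/= -!normE ler_normD. Qed.

Lemma rnormN x : rnorm (- x) = rnorm x.
Proof. by rewrite /rnorm normrN. Qed.

Lemma rnormB x y : rnorm (x - y) = rnorm (y - x).
Proof. by rewrite -rnormN opprB. Qed.

Lemma rnormZ (a : R[i]) x : rnorm (a *: x) = normc a * rnorm x.
Proof.
by rewrite {1}/rnorm normrZ normE -[`|a|]/(normc a)%:C%C -rmorphM.
Qed.

Lemma closed_rnormP (A : set H) :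
  closed A <->
  forall l, (forall e, 0 < e -> exists2 a, A a & rnorm (l - a) < e) -> A l.
Proof.
split=> [cA l lA|cA l lA].
  apply: cA => B /nbhs_ballP [e /= e0 leB].
  have e0' : 0 < complex.Re e by move: e0; rewrite ltcE /= => /andP[].
  have [a Aa la] := lA _ e0'; exists a; split=> //; apply: leB.
  rewrite -ball_normE /ball_ /= normE ltcE /= la andbT.
  by move: e0; rewrite ltcE /= => /andP[].
apply: cA => e e0; have /lA [a [Aa la]] : nbhs l (ball l e%:C%C).
  by apply: nbhsx_ballx; rewrite ltcR.
by exists a => //; move: la; rewrite -ball_normE /ball_ /= normE ltcR.
Qed.

Definition rcvg (u : nat -> H) l :=
  forall e, 0 < e -> exists N, forall n, (N <= n)%N -> rnorm (l - u n) < e.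

Lemma rnorm_complete (u : nat -> H) :
  (forall e, 0 < e -> exists N, forall m n, (N <= m)%N -> (N <= n)%N ->
    rnorm (u m - u n) < e) -> exists l, rcvg u l.
Proof.
move=> uC; have : cvg (u @ \oo).
  apply: cauchy_cvg; apply: cauchy_exP => e e0.
  have [e0' eE] : 0 < complex.Re e /\ (complex.Re e)%:C%C = e.
    by split; [move: e0; rewrite ltcE /= => /andP[]|rewrite RRe_real ?gtr0_real].
  have [N uN] := uC _ e0'; exists (u N); exists N => // n /= Nn.
  by rewrite -ball_normE /ball_ /= normE -eE ltcR uN.
move=> /cvg_ex [l /cvgrPdist_lt ul]; exists l => e e0.
have [|N _ uN] := ul e%:C%C; first by rewrite ltcR.
by exists N => n Nn; have := uN n Nn; rewrite /= normE ltcR.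
Qed.

End RealNorm.

(** * The projection theorem, Riesz representation and Hellinger-Toeplitz *)

Section DotGeometry.
Variables (R : realType) (H : completeNormedModType R[i]).
Variable dot : {dot H for Num.conj}.
Hypothesis H_hilbert : norm_from_dot dot.
Implicit Types x y z : H.

Lemma dotxx x : dot x x = (rnorm x ^+ 2)%:C%C.
Proof. by rewrite -H_hilbert normE rmorphXn. Qed.

Lemma dotC x y : dot x y = Num.conj (dot y x).
Proof. by rewrite hermC/= expr0 mul1r. Qed.

Lemma rnorm_parallelogram x y :
  rnorm (x + y) ^+ 2 + rnorm (x - y) ^+ 2 = 2 * rnorm x ^+ 2 + 2 * rnorm y ^+ 2.
Proof.
apply: complexI; rewrite !rmorphD/= !(rmorphM _ 2) /= -!dotxx dnormD dnormB.
rewrite rmorph_nat; ring.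
Qed.

Lemma dot_inj x y : (forall z, dot z x = dot z y) -> x = y.
Proof.
move=> xy; apply/eqP; rewrite -subr_eq0 -(dnorm_eq0 dot) linearBr /= xy.
by rewrite subrr.
Qed.

(** Removing from x its component along y shortens it by an amount governed by
    <x, y>.  That the left side is nonnegative is the Cauchy-Schwarz
    inequality; that a nearest point cannot be improved in this way is the
    orthogonality in the projection theorem. *)
Lemma rnorm_sub_component x y :
  rnorm (x - (dot x y / dot y y) *: y) ^+ 2 * rnorm y ^+ 2 =
  rnorm x ^+ 2 * rnorm y ^+ 2 - normc (dot x y) ^+ 2.
Proof.
have [->|y0] := eqVneq y 0.
  have -> : rnorm (0 : H) = 0 by rewrite /rnorm normr0.
  by rewrite linear0r normc0 expr0n/= !mulr0 subr0.
have n0 : dot y y != 0 by rewrite dnorm_eq0.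
apply: complexI; rewrite rmorphB/= normc_sqr !(rmorphM _ (rnorm _ ^+ 2))/=.
rewrite -!dotxx dnormB dnormZ linearZr_LR /= normCK.
rewrite rmorphM fmorphV/= -(dotC y y).
rewrite !rmorphM /= conjCK fmorphV /= -(dotC y y).
by field.
Qed.

Lemma cauchy_schwarz x y : normc (dot x y) <= rnorm x * rnorm y.
Proof.
rewrite -ler_sqr ?nnegrE ?normc_ge0 ?mulr_ge0 ?rnorm_ge0 // exprMn -subr_ge0.
by rewrite -rnorm_sub_component mulr_ge0 ?sqr_ge0.
Qed.

End DotGeometry.

Lemma functionalB (K : pzRingType) (V : lmodType K) (phi : V -> K) :
  (forall a x y, phi (a *: x + y) = a * phi x + phi y) ->
  forall x y, phi (x - y) = phi x - phi y.
Proof. by move=> phiL x y; rewrite addrC -scaleN1r phiL mulN1r addrC. Qed.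

Section ClosedSubspaces.
Variables (R : realType) (H : completeNormedModType R[i]).
Implicit Types (x y z : H) (S : set H).

Lemma closed_submodP S : closed_subspace S <->
  [/\ S 0, forall a s t, S s -> S t -> S (a *: s + t) & closed S].
Proof.
split=> [[[S0 SL] cS]|[S0 SL cS]]; split => //.
- exact/asboolP.
- by move=> a s t Ss St; apply/asboolP/(SL a s t); exact/asboolP.
- split; first exact/asboolP.
  by move=> a s t /asboolP Ss /asboolP St; apply/asboolP; exact: SL.
Qed.

Lemma closed_subspace_ker (phi : H -> R[i]) (C : R) :
  (forall a x y, phi (a *: x + y) = a * phi x + phi y) ->
  (forall x, normc (phi x) <= C * rnorm x) ->
  closed_subspace [set x | phi x = 0].
Proof.
move=> phiL phiC.
have phiB := functionalB phiL.
have phi0 : phi 0 = 0 by rewrite -(subrr 0) phiB subrr.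
apply/closed_submodP; split => //= [a s t s0 t0|].
  by rewrite phiL s0 t0 mulr0 addr0.
apply/closed_rnormP => l lS; apply: normc_le0; apply/ler_addgt0Pr => e e0.
have C0 : 0 < `|C| + 1 by rewrite ltr_wpDl.
have [s /= s0 ls] := lS (e / (`|C| + 1)) (divr_gt0 e0 C0).
have := phiC (l - s); rewrite phiB s0 subr0 add0r => /le_trans; apply.
rewrite ltr_pdivlMr // in ls.
have := rnorm_ge0 (l - s); have := ler_norm C; nra.
Qed.

End ClosedSubspaces.

Section HilbertSpace.
Variables (R : realType) (H : completeNormedModType R[i]).
Variable dot : {dot H for Num.conj}.
Hypothesis H_hilbert : norm_from_dot dot.
Implicit Types (x y z : H) (T : H -> H).

(** A sequence of points of S whose distances to x tend to the infimum d is
    Cauchy by the parallelogram law, because midpoints stay in S, at distance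
    at least d from x. *)
Lemma projection_theorem (S : set H) x : closed_subspace S ->
  exists2 s, S s & forall t, S t -> dot (x - s) t = 0.
Proof.
move=> /closed_submodP[S0 SL cS].
have SD s t : S s -> S t -> S (s + t).
  by move=> Ss St; rewrite -[s]scale1r; exact: SL.
have SZ a s : S s -> S (a *: s).
  by move=> Ss; rewrite -[_ *: _]addr0; exact: SL.
pose D := [set rnorm (x - s) | s in S].
have Dlb : lbound D 0 by move=> _ [s _ <-]; exact: rnorm_ge0.
have Dinf : has_inf D.
  by split; [exists (rnorm (x - 0)), 0|exists 0].
pose d := inf D.
have d_le s : S s -> d <= rnorm (x - s).
  by move=> Ss; apply: ge_inf; [exists 0|exists s].
have d0 : 0 <= d by apply: lb_le_inf => //; case: Dinf.
have dn e : 0 < e -> exists2 s, S s & rnorm (x - s) < d + e.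
  by move=> e0; have [_ [s Ss <-] xs] := inf_adherent e0 Dinf; exists s.
have xn n : exists s, S s /\ rnorm (x - s) < d + n.+1%:R^-1.
  by have [|s Ss xs] := dn n.+1%:R^-1; [rewrite invr_gt0|exists s].
have [u uP] := choice xn.
have mid s t : S s -> S t ->
    rnorm (s - t) ^+ 2 <=
    2 * rnorm (x - s) ^+ 2 + 2 * rnorm (x - t) ^+ 2 - 4 * d ^+ 2.
  move=> Ss St; have := rnorm_parallelogram H_hilbert (x - s) (x - t).
  have -> : x - s - (x - t) = - (s - t).
    by rewrite opprB addrC opprB addrA subrK.
  have -> : x - s + (x - t) = 2 *: (x - 2^-1 *: (s + t)).
    rewrite scalerBr scalerA divff ?pnatr_eq0 // scale1r scaler_nat.
    by rewrite opprD addrACA.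
  rewrite rnormN rnormZ.
  have -> : normc (2 : R[i]) = 2.
    by apply: complexI; rewrite -norm_normc normr_nat rmorph_nat.
  have := d_le _ (SZ 2^-1 _ (SD _ _ Ss St)) => dle.
  have : d ^+ 2 <= rnorm (x - 2^-1 *: (s + t)) ^+ 2.
    by rewrite ler_sqr ?nnegrE ?rnorm_ge0.
  by lra.
have [|s us] := @rnorm_complete _ _ u.
  (* Distances below d + min c 1 give, through the midpoint estimate, a
     squared gap below 4 (2 d + 1) c, which is at most e ^ 2. *)
  move=> e e0; pose c := e ^+ 2 / (8 * (d + 1)).
  have c0 : 0 < c by rewrite divr_gt0 ?exprn_gt0// mulr_gt0// ltr_wpDl.
  pose g := Num.min c 1.
  have g0 : 0 < g by rewrite lt_min c0 ltr01.
  pose N := Num.truncn g^-1.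
  have Ninv m : (N <= m)%N -> m.+1%:R^-1 < g.
    move=> Nm; rewrite invf_plt ?posrE // (lt_le_trans (truncnS_gt _)) //.
    by rewrite ler_nat ltnS.
  exists N => m n Nm Nn.
  have [[Sm um] [Sn un]] := (uP m, uP n).
  have := mid _ _ Sm Sn; have := Ninv _ Nm; have := Ninv _ Nn.
  set a := m.+1%:R^-1 in um *; set b := n.+1%:R^-1 in un *.
  have a0 : 0 < a by rewrite invr_gt0.
  have b0 : 0 < b by rewrite invr_gt0.
  have := rnorm_ge0 (x - u m); have := rnorm_ge0 (x - u n).
  move: um un; set p := rnorm _; set q := rnorm _ => um un p0 q0.
  rewrite !lt_min => /andP[bc b1] /andP[ac a1] le.
  rewrite -ltr_sqr ?nnegrE ?rnorm_ge0 ?(ltW e0)//; apply: le_lt_trans le _.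
  have ec : e ^+ 2 = 8 * (d + 1) * c.
    by rewrite mulrC divfK // mulf_neq0 ?pnatr_eq0// gt_eqF// ltr_wpDl.
  have p2 : p ^+ 2 <= (d + a) ^+ 2 by rewrite ler_sqr ?nnegrE; lra.
  have q2 : q ^+ 2 <= (d + b) ^+ 2 by rewrite ler_sqr ?nnegrE; lra.
  nra.
have Ss : S s.
  apply: (closed_rnormP S).1 => // e e0; have [N uN] := us e e0.
  by exists (u N); [exact: (uP N).1|exact: uN].
have sd : rnorm (x - s) <= d.
  apply/ler_addgt0Pr => e e0; have e2 : 0 < e / 2 by rewrite divr_gt0.
  have [N uN] := us _ e2; pose n := maxn N (Num.truncn (e / 2)^-1).
  have := uN n (leq_maxl _ _); have := (uP n).2.
  have : n.+1%:R^-1 < e / 2.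
    rewrite invf_plt ?posrE // (lt_le_trans (truncnS_gt _)) //.
    by rewrite ler_nat ltnS leq_maxr.
  have := rnormD (x - u n) (u n - s).
  rewrite addrA subrK (rnormB (u n)); move: (n.+1%:R^-1) => a; lra.
exists s => // t St; have := rnorm_sub_component H_hilbert (x - s) t.
set a := _ / _ => aE.
(* Both s and s + a t are points of S, and s is a nearest one. *)
have := d_le _ (SD _ _ Ss (SZ a _ St)); rewrite opprD addrA => dle.
have : normc (dot (x - s) t) ^+ 2 <= 0.
  have : d ^+ 2 <= rnorm (x - s - a *: t) ^+ 2.
    by rewrite ler_sqr ?nnegrE ?rnorm_ge0.
  have : rnorm (x - s) ^+ 2 <= d ^+ 2 by rewrite ler_sqr ?nnegrE ?rnorm_ge0.
  have := sqr_ge0 (rnorm t); nra.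
rewrite le_eqVlt ltNge sqr_ge0 orbF sqrf_eq0 => /eqP n0.
exact: eq0_normc n0.
Qed.

(** If phi is not zero, a vector z orthogonal to its kernel represents it up to
    a scalar, because every x differs from a multiple of z by an element of the
    kernel. *)
Lemma riesz_representation (phi : H -> R[i]) (C : R) :
  (forall a x y, phi (a *: x + y) = a * phi x + phi y) ->
  (forall x, normc (phi x) <= C * rnorm x) ->
  exists h, forall x, phi x = dot x h.
Proof.
move=> phiL phiC.
have phiB := functionalB phiL.
have phi0 : phi 0 = 0 by rewrite -(subrr 0) phiB subrr.
have [[x0 x0P]|/forallNP phi_eq0] := pselect (exists x, phi x <> 0); last first.
  by exists 0 => x; rewrite linear0r; apply: contrapT; exact: phi_eq0.
have cS := closed_subspace_ker phiL phiC.
have [s Ss so] := projection_theorem x0 cS.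
set z := x0 - s in so; have z0 : phi z != 0 by rewrite phiB Ss subr0; exact/eqP.
exists ((Num.conj (phi z) / dot z z) *: z) => x.
have dz : dot z z != 0.
  by rewrite dnorm_eq0; apply: contraNneq z0 => ->; rewrite phi0.
have : dot z (x - (phi x / phi z) *: z) = 0.
  by apply: so; rewrite /= addrC -scaleNr phiL mulNr divfK // addNr.
rewrite dotC => /eqP.
rewrite fmorph_eq0 linearBl linearZl_LR /= subr_eq0 => /eqP xz.
rewrite linearZr_LR /= xz rmorphM fmorphV /= conjCK -(dotC dot z z).
by field; rewrite z0.
Qed.

(** A complex constant M bounding norms may be replaced by a real one, since the
    order of R[i] forces M * `|x| to be real. *)
Lemma bounded_operatorP T : bounded_operator T <->
  linear T /\ exists2 C : R, 0 <= C & forall x, rnorm (T x) <= C * rnorm x.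
Proof.
split=> [[LT [M TM]]|[LT [C C0 TC]]]; split=> //; last first.
  by exists C%:C%C => x; rewrite !normE -rmorphM lecR.
exists `|complex.Re M| => // x; have := TM x; rewrite !normE => h.
have {h} : complex.Re (rnorm (T x))%:C%C <= complex.Re (M * (rnorm x)%:C%C).
  by move: h; rewrite lecE => /andP[].
case: M {TM} => a b /=; rewrite mulr0 subr0 => /le_trans; apply.
by rewrite ler_wpM2r ?rnorm_ge0 // ler_norm.
Qed.

(** Gliding hump.  If T is unbounded, pick v n with T (v n) large with respect
    to v n, and build x as a sum of steps of length 3 ^- n along T (v n), each
    sign being chosen so that <x, T (v n)> does not cancel.  The later steps
    are too short to spoil this, so <x, T (v n)> = <T' x, v n> is large with
    respect to v n for every n, which the Cauchy-Schwarz inequality forbids. *)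
Lemma hellinger_toeplitz T T' : linear T ->
  (forall x y, dot (T x) y = dot x (T' y)) -> bounded_operator T.
Proof.
move=> LT TT'; apply/bounded_operatorP; split=> //; apply: contrapT => nC.
pose q n : R := (3 ^+ n)^-1.
have q0 n : 0 < q n by rewrite invr_gt0 exprn_gt0.
have qS n : q n.+1 = q n / 3 by rewrite /q exprS invfM mulrC.
have qlt e : 0 < e -> exists N, q N < e.
  move=> e0; exists (Num.truncn e^-1); rewrite invf_plt ?posrE ?exprn_gt0//.
  rewrite (lt_le_trans (truncnS_gt _)) // -natrX ler_nat; exact: ltn_expl.
have vP n : exists v, n%:R * 3 ^+ n * rnorm v < rnorm (T v).
  apply: contrapT => /forallNP nv; apply: nC; exists (n%:R * 3 ^+ n) => [|x].
    by rewrite mulr_ge0 ?exprn_ge0.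
  by rewrite leNgt; apply/negP; exact: nv.
have [v {}vP] := choice vP; pose w n := T (v n).
have w0 n : 0 < rnorm (w n).
  by rewrite (le_lt_trans _ (vP n)) // !mulr_ge0 ?exprn_ge0 ?rnorm_ge0.
(* Of y + d and y - d at least one has an inner product with w n of modulus at
   least that of d, by the triangle inequality. *)
have stepP (ny : nat * H) : exists z, rnorm (z - ny.2) <= q ny.1 /\
    q ny.1 * rnorm (w ny.1) <= normc (dot z (w ny.1)).
  case: ny => n y /=; pose d := (q n / rnorm (w n))%:C%C *: w n.
  have dn : rnorm d = q n.
    by rewrite /d rnormZ normc_real ?divr_ge0 ?ltW // divfK // gt_eqF.
  have dd : normc (dot d (w n)) = q n * rnorm (w n).
    rewrite /d linearZl_LR /= (dotxx H_hilbert) -rmorphM normc_real /=.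
      by rewrite expr2 mulrA divfK // gt_eqF.
    by rewrite mulr_ge0 ?sqr_ge0 // divr_ge0 ?ltW.
  have : 2 * (q n * rnorm (w n)) <=
      normc (dot (y + d) (w n)) + normc (dot (y - d) (w n)).
    rewrite -dd; have := normcD (dot (y + d) (w n)) (- dot (y - d) (w n)).
    rewrite normcN -linearBl /= opprB addrC addrA subrK.
    rewrite linearDl /=; set z := dot d _.
    have -> : z + z = (2 : R)%:C%C * z by rewrite rmorph_nat mulr_natl.
    by rewrite normcM normc_real.
  have [le1 _|lt1 le2] :=
    leP (q n * rnorm (w n)) (normc (dot (y + d) (w n))).
    by exists (y + d); rewrite addrC addKr dn.
  exists (y - d); rewrite addrC addKr rnormN dn; split=> //; lra.
have [step {}stepP] := choice stepP.
pose fix u n := if n is m.+1 then step (m, u m) else 0.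
have uS n : rnorm (u n.+1 - u n) <= q n by have [] := stepP (n, u n).
have uw n : q n * rnorm (w n) <= normc (dot (u n.+1) (w n)).
  by have [] := stepP (n, u n).
(* Sum of a geometric series of ratio 1 / 3. *)
have tail n k : rnorm (u (n + k)%N - u n) <= 3 / 2 * (q n - q (n + k)%N).
  elim: k => [|k IH]; first by rewrite addn0 !subrr /rnorm normr0 mulr0.
  have := rnormD (u (n + k.+1)%N - u (n + k)%N) (u (n + k)%N - u n).
  rewrite addrA subrK; have := uS (n + k)%N; rewrite addnS (qS (n + k)%N); lra.
have tail' n m : (n <= m)%N -> rnorm (u m - u n) <= 3 / 2 * q n.
  move=> nm; have := tail n (m - n)%N; rewrite subnKC //; have := q0 m; lra.
have [|x ux] := @rnorm_complete _ _ u.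
  move=> e e0; have [N qN] := qlt (e / 3) (divr_gt0 e0 (ltr0n _ 3)).
  exists N => m n Nm Nn; have := rnormD (u m - u N) (u N - u n).
  rewrite addrA subrK (rnormB (u N)).
  have := tail' _ _ Nm; have := tail' _ _ Nn; lra.
have xn n : rnorm (x - u n.+1) <= q n / 2.
  apply/ler_addgt0Pr => e e0; have [N uN] := ux e e0.
  have := uN _ (leq_maxl N n.+1); have := tail' _ _ (leq_maxr N n.+1).
  have := rnormD (x - u (maxn N n.+1)) (u (maxn N n.+1) - u n.+1).
  rewrite addrA subrK qS; lra.
(* The remaining steps sum to at most half of the step along w n, so at least
   half of its contribution to the inner product survives in the limit. *)
have ub n : n%:R / 2 <= rnorm (T' x).
  have le1 : normc (dot x (w n)) <= rnorm (v n) * rnorm (T' x).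
    by rewrite dotC /w TT' normcJ; exact: cauchy_schwarz.
  have le2 := cauchy_schwarz H_hilbert (x - u n.+1) (w n).
  have := normcD (dot x (w n)) (- dot (x - u n.+1) (w n)).
  rewrite normcN -linearBl /= opprB addrC subrK => le3.
  have := vP n; have := uw n; have := xn n; have := w0 n; rewrite -/(w n).
  have : q n * 3 ^+ n = 1 by rewrite mulVf // expf_eq0 pnatr_eq0 andbF.
  move: le1 le2 le3; set t := rnorm (T' x); set W := rnorm (w n).
  set V := rnorm (v n); set a := normc _; set b := normc _; set c := normc _.
  set D := rnorm _; set k := n%:R.
  set Q := q n; set P := 3 ^+ n.
  move=> le1 le2 le3 QP W0 DQ QW kW.
  have Q0 : 0 < Q by exact: q0.
  have V0 : 0 <= V by exact: rnorm_ge0.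
  have h1 : D * W <= Q / 2 * W by rewrite ler_pM2r.
  have h2 : Q * (k * P * V) < Q * W by rewrite ltr_pM2l.
  have {}h2 : k * V < Q * W.
    by move: h2; rewrite -(mulrA k) mulrCA [Q * (P * _)]mulrA QP mul1r.
  rewrite leNgt; apply/negP => /ltW /(ler_wpM2l V0); lra.
have := ub (2 * (Num.truncn (rnorm (T' x))).+1)%N.
by rewrite natrM mulrC mulKf ?pnatr_eq0 // leNgt truncnS_gt.
Qed.

End HilbertSpace.

(** * The ring of bounded operators and its J-adjoint *)

Section BoundedOperators.
Variables (R : realType) (H : completeNormedModType R[i]).
Implicit Types (x y z : H) (T : H -> H).

Lemma bounded_operator_id : bounded_operator (id : H -> H).
Proof. by split => //; exists 1 => x; rewrite mul1r. Qed.

Lemma bounded_operator_comp T1 T2 :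
  bounded_operator T1 -> bounded_operator T2 -> bounded_operator (T1 \o T2).
Proof.
move=> /bounded_operatorP[L1 [C1 C10 B1]] /bounded_operatorP[L2 [C2 C20 B2]].
apply/bounded_operatorP; split=> [a x y|]; first by rewrite /= L2 L1.
exists (C1 * C2) => [|x]; first exact: mulr_ge0.
by rewrite /= (le_trans (B1 _)) // -mulrA ler_wpM2l.
Qed.

Lemma bounded_operator_sub T1 T2 :
  bounded_operator T1 -> bounded_operator T2 -> bounded_operator (T1 - T2).
Proof.
move=> /bounded_operatorP[L1 [C1 C10 B1]] /bounded_operatorP[L2 [C2 C20 B2]].
apply/bounded_operatorP; split=> [a x y|].
  by rewrite /= !fctE L1 L2 scalerBr opprD addrACA.
exists (C1 + C2) => [|x]; first exact: addr_ge0.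
by rewrite !fctE (le_trans (rnormD _ _)) // rnormN mulrDl lerD.
Qed.

Lemma bounded_operator_scale (a : R[i]) :
  bounded_operator (fun x : H => a *: x).
Proof.
split=> [b x y|]; first by rewrite scalerDr !scalerA mulrC.
by exists `|a| => x; rewrite normrZ.
Qed.

Definition boundedp : {pred H -> H} := fun T => `[< bounded_operator T >].

Lemma boundedp_zmod_closed : zmod_closed boundedp.
Proof.
split=> [|T1 T2]; last first.
  by move=> /asboolP ? /asboolP ?; apply/asboolP/bounded_operator_sub.
apply/asboolP; rewrite -(subrr id).
by apply: bounded_operator_sub; exact: bounded_operator_id.
Qed.

HB.instance Definition _ :=
  GRing.isZmodClosed.Build (H -> H) boundedp boundedp_zmod_closed.

Record boperator := BOperator { bop : H -> H; bopP : bop \in boundedp }.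
HB.instance Definition _ := [isSub for bop].
HB.instance Definition _ := [Choice of boperator by <:].
HB.instance Definition _ := [SubChoice_isSubZmodule of boperator by <:].

Implicit Types A B C : boperator.

Lemma bop_bounded A : bounded_operator (bop A).
Proof. exact/asboolP/bopP. Qed.

Definition mkbop T (bT : bounded_operator T) : boperator :=
  BOperator (introT (asboolP _) bT).

Definition bop1 := mkbop bounded_operator_id.
Definition bopM A B :=
  mkbop (bounded_operator_comp (bop_bounded A) (bop_bounded B)).

Lemma bop_inj A B : (forall x, bop A x = bop B x) -> A = B.
Proof. by move=> AB; apply/val_inj/funext. Qed.

Lemma bopD A B x : bop (A + B) x = bop A x + bop B x.
Proof. by []. Qed.

Lemma bop_linear A a x y : bop A (a *: x + y) = a *: bop A x + bop A y.
Proof. exact: (bop_bounded A).1. Qed.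

Fact bopMA : associative bopM. Proof. by move=> A B C; exact: bop_inj. Qed.
Fact bop1M : left_id bop1 bopM. Proof. by move=> A; exact: bop_inj. Qed.
Fact bopM1 : right_id bop1 bopM. Proof. by move=> A; exact: bop_inj. Qed.
Fact bopMDl : left_distributive bopM +%R.
Proof. by move=> A B C; exact: bop_inj. Qed.
Fact bopMDr : right_distributive bopM +%R.
Proof.
move=> A B C; apply: bop_inj => x.
rewrite -[LHS]/(bop A (bop B x + bop C x)) -{1}[bop B x]scale1r bop_linear.
by rewrite scale1r.
Qed.
HB.instance Definition _ := GRing.Zmodule_isPzRing.Build boperator
  bopMA bop1M bopM1 bopMDl bopMDr.

Lemma bopE A B x : bop (A * B) x = bop A (bop B x).
Proof. by []. Qed.
End BoundedOperators.

Section KreinAdjoint.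
Variables (R : realType) (H : completeNormedModType R[i]).
Variable dot : {dot H for Num.conj}.
Hypothesis H_hilbert : norm_from_dot dot.
Implicit Types (x y z : H) (T : H -> H).

Lemma adjointP T : bounded_operator T ->
  forall x y, dot (T x) y = dot x (adjoint dot T y).
Proof.
move=> /bounded_operatorP[LT [C C0 TC]] x y.
suff [h hP] : [set h | forall f, dot (T f) y = dot f h] !=set0.
  by rewrite /adjoint; case: xgetP => [k _ kP|/(_ h)//]; exact: kP.
apply: (riesz_representation H_hilbert (C := C * rnorm y)) => [a u v|u].
  by rewrite LT linearDl linearZl_LR.
rewrite (le_trans (cauchy_schwarz H_hilbert _ _)) // mulrAC.
by rewrite ler_wpM2r ?rnorm_ge0.
Qed.

(** The square of the norm of T* x is <T T* x, x>, at most
    C |T* x| |x|. *)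
Lemma adjoint_bounded T :
  bounded_operator T -> bounded_operator (adjoint dot T).
Proof.
move=> bT; have TP := adjointP bT; have /bounded_operatorP[LT [C C0 TC]] := bT.
apply/bounded_operatorP; split=> [a x y|].
  apply: (dot_inj (dot := dot)) => z.
  by rewrite linearDr linearZr_LR /= -!TP linearDr linearZr_LR.
exists C => // x; have [->|n0] := eqVneq (rnorm (adjoint dot T x)) 0.
  by rewrite mulr_ge0 ?rnorm_ge0.
have : 0 < rnorm (adjoint dot T x) by rewrite lt_def n0 rnorm_ge0.
move=> /ler_pM2l <-; rewrite -expr2.
have -> : rnorm (adjoint dot T x) ^+ 2 =
    normc (dot (T (adjoint dot T x)) x).
  by rewrite TP dotxx // normc_real // sqr_ge0.
rewrite (le_trans (cauchy_schwarz H_hilbert _ _)) // mulrCA mulrA.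
by rewrite ler_wpM2r ?rnorm_ge0.
Qed.

Variable J : H -> H.
Hypothesis J_symmetry : symmetry dot J.

Let J_bounded : bounded_operator J. Proof. by case: J_symmetry. Qed.
Let J_dot x y : dot (J x) y = dot x (J y).
Proof. by have [bJ aJ _] := J_symmetry; rewrite (adjointP bJ) aJ. Qed.
Let JK x : J (J x) = x.
Proof. by have [_ _ JJ] := J_symmetry; rewrite -[J (J x)]/((J \o J) x) JJ. Qed.

Lemma krein_Jadjoint T x y : bounded_operator T ->
  krein dot J (T x) y = krein dot J x (Jadjoint dot J T y).
Proof.
by move=> bT; rewrite /krein /Jadjoint /= J_dot (adjointP bT) J_dot JK.
Qed.

Lemma krein_sym x y : krein dot J x y = Num.conj (krein dot J y x).
Proof. by rewrite /krein J_dot -dotC. Qed.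

Lemma krein_inj x y : (forall z, krein dot J z x = krein dot J z y) -> x = y.
Proof.
by move=> xy; apply: (dot_inj (dot := dot)) => z; rewrite -[z]JK; exact: xy.
Qed.

Lemma Jadjoint_bounded T :
  bounded_operator T -> bounded_operator (Jadjoint dot J T).
Proof.
by move=> bT; do 2?apply: bounded_operator_comp => //; exact: adjoint_bounded.
Qed.

(** Hellinger-Toeplitz carries over to the indefinite form because J T is
    symmetric for the inner product. *)
Lemma krein_symmetric_bounded T : linear T ->
  (forall x y, krein dot J (T x) y = krein dot J x (T y)) -> bounded_operator T.
Proof.
move=> LT TT; have LJ := J_bounded.1.
have -> : T = J \o (J \o T) by apply/funext => x /=; rewrite JK.
apply: bounded_operator_comp => //.
apply: (hellinger_toeplitz H_hilbert (T' := J \o T)) => [a x y|x y] /=.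
  by rewrite LT LJ.
by rewrite [LHS]TT /krein J_dot.
Qed.

Definition bstar (A : boperator H) : boperator H :=
  mkbop (Jadjoint_bounded (bop_bounded A)).

Lemma krein_bstar A x y :
  krein dot J (bop A x) y = krein dot J x (bop (bstar A) y).
Proof. exact/krein_Jadjoint/bop_bounded. Qed.

Lemma kreinL a x y z :
  krein dot J (a *: x + y) z = a * krein dot J x z + krein dot J y z.
Proof. by rewrite /krein J_bounded.1 linearDl linearZl_LR. Qed.

(** Nondegeneracy of the form makes the J-adjoint the only operator with its
    defining property; the algebraic laws of the involution below follow. *)
Lemma bstar_unique A B :
  (forall x y, krein dot J (bop A x) y = krein dot J x (bop B y)) ->
  bstar A = B.
Proof.
move=> AB; apply: bop_inj => y; apply: krein_inj => x.
by rewrite -krein_bstar AB.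
Qed.

Lemma bstarD : {morph bstar : A B / A + B}.
Proof.
move=> A B; apply: bstar_unique => x y.
rewrite !bopD -[bop A x]scale1r kreinL mul1r !krein_bstar.
by rewrite /krein linearDr.
Qed.

Lemma bstarM A B : bstar (A * B) = bstar B * bstar A.
Proof. by apply: bstar_unique => x y; rewrite !bopE !krein_bstar. Qed.

Lemma bstarK : involutive bstar.
Proof.
move=> A; apply: bstar_unique => x y.
by rewrite krein_sym -krein_bstar -krein_sym.
Qed.

End KreinAdjoint.

(** * The action on J-normal projections *)

Lemma image_range_comp (X Y Z : Type) (g : Y -> Z) (f : X -> Y) :
  range (g \o f) = g @` range f.
Proof. by rewrite image_comp. Qed.

Section Action.
Variables (R : realType) (H : completeNormedModType R[i]).
Variable dot : {dot H for Num.conj}.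
Hypothesis H_hilbert : norm_from_dot dot.
Variable J : H -> H.
Hypothesis J_symmetry : symmetry dot J.
Variable S : set H.
Implicit Types (x y z : H) (T Q U : H -> H) (A B C : boperator H).

Local Notation star := (bstar H_hilbert J_symmetry).

Lemma Jnormal_projectionP Q : Jnormal_projections dot J S Q <->
  exists A, [/\ Q = bop A, normal_idempotent star A & range (bop A) = S].
Proof.
split=> [[bQ QQ QC QS]|[A [-> [AA AC] AS]]].
  exists (mkbop bQ); split=> //; split; apply: bop_inj => x.
    exact: (congr1 (@^~ x) QQ).
  exact: (congr1 (@^~ x) QC).
split=> //; first exact: bop_bounded.
  exact: (congr1 (@bop _ _) AA).
exact: (congr1 (@bop _ _) AC).
Qed.

Lemma JunitaryP U : Junitaries_preserving dot J S U <->
  exists A, [/\ U = bop A, unitary star A & bop A @` S = S].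
Proof.
split=> [[bU UU UU' US]|[A [-> [AA AA'] AS]]].
  exists (mkbop bU); split=> //; split; apply: bop_inj => x.
    exact: (congr1 (@^~ x) UU).
  exact: (congr1 (@^~ x) UU').
split=> //; first exact: bop_bounded.
  exact: (congr1 (@bop _ _) AA).
exact: (congr1 (@bop _ _) AA').
Qed.

Lemma unitary_bopK A : unitary star A ->
  cancel (bop (star A)) (bop A) /\ cancel (bop A) (bop (star A)).
Proof.
case=> h1 h2; split=> x.
  by rewrite -[LHS]/(bop (A * star A) x) h1.
by rewrite -[LHS]/(bop (star A * A) x) h2.
Qed.

Lemma unitary_range A : unitary star A -> range (bop A) = setT.
Proof.
move=> /unitary_bopK[AK _]; apply/seteqP; split=> // x _.
by exists (bop (star A) x).
Qed.

Lemma Junitaries_group : transformation_group (Junitaries_preserving dot J S).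
Proof.
have sD := bstarD H_hilbert J_symmetry; have sM := bstarM H_hilbert J_symmetry.
have sK := bstarK H_hilbert J_symmetry.
split.
- apply/JunitaryP; exists 1; split=> //; last exact: image_id.
  exact: unitary1.
- move=> _ _ /JunitaryP[A [-> uA AS]] /JunitaryP[B [-> uB BS]].
  apply/JunitaryP; exists (A * B); split=> //; first exact: unitaryM.
  by rewrite -[bop (A * B)]/(bop A \o bop B) -image_comp BS AS.
move=> _ /JunitaryP[A [-> uA AS]]; have [AsK sAK] := unitary_bopK uA.
have [h1 h2] := (funext AsK : bop A \o _ = id, funext sAK : _ \o bop A = id).
exists (bop (star A)); split => //; apply/JunitaryP; exists (star A).
split=> //; first exact: unitary_star.
by rewrite -{1}AS image_comp h2 image_id.
Qed.

Lemma Jconjugation_action : group_action_on (Junitaries_preserving dot J S)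
  (Jnormal_projections dot J S) (Jconjugation dot J).
Proof.
have sM := bstarM H_hilbert J_symmetry; have sK := bstarK H_hilbert J_symmetry.
have sD := bstarD H_hilbert J_symmetry.
split.
- move=> _ _ /JunitaryP[A [-> uA AS]] /Jnormal_projectionP[B [-> nB BS]].
  apply/Jnormal_projectionP; exists (A * B * star A).
  split=> //; first exact: normal_idempotent_conj.
  rewrite -[bop _]/(bop A \o (bop B \o bop (star A))) 2!image_range_comp.
  by rewrite unitary_range ?BS //; exact: unitary_star.
- move=> _ /Jnormal_projectionP[B [-> _ _]].
  rewrite -[id]/(bop (1 : boperator H)) -[LHS]/(bop (1 * B * star 1)).
  by rewrite star1 // mul1r mulr1.
- move=> _ _ Q /JunitaryP[A [-> _ _]] /JunitaryP[B [-> _ _]].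
  move=> /Jnormal_projectionP[C [-> _ _]].
  rewrite -[LHS]/(bop (A * B * C * star (A * B))).
  rewrite -[RHS]/(bop (A * (B * C * star B) * star A)).
  by rewrite sM !mulrA.
Qed.

Lemma Junitaries_transitive Q1 Q2 :
  Jnormal_projections dot J S Q1 -> Jnormal_projections dot J S Q2 ->
  exists2 U, Junitaries_preserving dot J S U & Jconjugation dot J U Q1 = Q2.
Proof.
move=> /Jnormal_projectionP[A [-> nA AS]] /Jnormal_projectionP[B [-> nB BS]].
(* A projection acts as the identity on its range, so two projections with the
   same range absorb each other on the left. *)
have absorb A' B' : normal_idempotent star A' -> range (bop A') = S ->
    range (bop B') = S -> A' * B' = B'.
  move=> [AA' _] AS' BS'; apply: bop_inj => x; rewrite bopE.
  have : S (bop B' x) by rewrite -BS'; exists x.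
  by rewrite -AS' => -[y _ <-]; rewrite -bopE AA'.
have [V uV VA] := normal_idempotents_conjugate (bstarD H_hilbert J_symmetry)
  (bstarM H_hilbert J_symmetry) (bstarK H_hilbert J_symmetry) nA nB
  (absorb _ _ nA AS BS) (absorb _ _ nB BS AS).
exists (bop V).
  apply/JunitaryP; exists V; split=> //.
  rewrite -{1}AS -image_range_comp -[bop V \o bop A]/(bop (V * A)) VA.
  by rewrite -[bop _]/(bop B \o bop V) image_range_comp unitary_range.
rewrite -[LHS]/(bop (V * A * star V)) VA; congr bop.
by rewrite -mulrA uV.1 mulr1.
Qed.

End Action.

(** * Existence of J-normal projections *)

Section HermitianProjection.
Variables (R : realType) (H : lmodType R[i]).
Variables (form : H -> H -> R[i]) (M : set H).
Hypothesis formL :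
  forall a x y z, form (a *: x + y) z = a * form x z + form y z.
Hypothesis formC : forall x y, form x y = Num.conj (form y x).
Hypothesis ML : forall a s t, M s -> M t -> M (a *: s + t).
Hypothesis M_nondegenerate :
  forall s, M s -> (forall t, M t -> form s t = 0) -> s = 0.
Hypothesis M_complemented :
  forall x, exists2 s, M s & forall t, M t -> form (x - s) t = 0.

(** For an arbitrary hermitian form, so that it yields both the orthogonal
    projections, for the inner product, and the J-selfadjoint ones, for the
    indefinite form.  A decomposition along M and its complement is unique as
    soon as the form is nondegenerate on M. *)
Lemma hermitian_projection : exists E : H -> H,
  [/\ linear E, (forall x, M (E x)), (forall s, M s -> E s = s),
      (forall x y, form (E x) y = form x (E y)) &
      forall x, (forall t, M t -> form x t = 0) -> E x = 0].
Proof.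
have formB x y z : form (x - y) z = form x z - form y z.
  exact: (functionalB (fun a u v => formL a u v z)).
have eP x : exists s, M s /\ forall t, M t -> form (x - s) t = 0.
  by have [s] := M_complemented x; exists s.
have [E EP] := choice eP.
have E_unique x s : M s -> (forall t, M t -> form (x - s) t = 0) -> E x = s.
  move=> Ms xs; have [MEx xE] := EP x; apply/eqP; rewrite -subr_eq0; apply/eqP.
  apply: M_nondegenerate => [|t Mt].
    by rewrite addrC -scaleN1r; exact: ML.
  have -> : E x - s = (x - s) - (x - E x).
    by rewrite opprB [RHS]addrC addrA subrK.
  by rewrite formB xs // xE // subrr.
exists E; split.
- move=> a x y; apply: E_unique => [|t Mt].
    by apply: ML; [exact: (EP x).1|exact: (EP y).1].
  by rewrite opprD addrACA -scalerBr formL (EP x).2 // (EP y).2 // mulr0 addr0.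
- by move=> x; exact: (EP x).1.
- move=> s Ms; apply: E_unique => // t Mt.
  by rewrite subrr -(subrr s) formB subrr.
- move=> x y; have [[Mx ox] [My oy]] := (EP x, EP y).
  have /eqP := ox _ My; rewrite formB subr_eq0 => /eqP ->.
  have /eqP := oy _ Mx; rewrite formB subr_eq0 => /eqP h.
  by rewrite formC h -formC.
- move=> x xM; apply: E_unique => [|t Mt]; last by rewrite subr0 xM.
  by have := ML (-1) (EP x).1 (EP x).1; rewrite scaleN1r addNr.
Qed.

End HermitianProjection.

Section Existence.
Variables (R : realType) (H : completeNormedModType R[i]).
Variable dot : {dot H for Num.conj}.
Hypothesis H_hilbert : norm_from_dot dot.
Variable J : H -> H.
Hypothesis J_symmetry : symmetry dot J.
Implicit Types (x y z : H) (S M N : set H).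

Local Notation star := (bstar H_hilbert J_symmetry).
Local Notation kr := (krein dot J).

Lemma closed_isotropic_part S :
  closed_subspace S -> closed_subspace (isotropic_part dot J S).
Proof.
move=> /closed_submodP[S0 SL cS].
have [/bounded_operatorP[JL [C C0 JC]] _ _] := J_symmetry.
have ker g : closed_subspace [set x | kr x g = 0].
  apply: (@closed_subspace_ker _ _ _ (C * rnorm g)) => [a x y|x].
    exact: (kreinL J_symmetry).
  rewrite (le_trans (cauchy_schwarz H_hilbert _ _)) // mulrAC.
  by rewrite ler_wpM2r ?rnorm_ge0.
apply/closed_submodP; split.
- split=> // g Sg; have /closed_submodP[h _ _] := ker g; exact: h.
- move=> a s t [Ss sS] [St tS]; split; first exact: SL.
  by move=> g Sg; rewrite (kreinL J_symmetry) sS // tS // mulr0 addr0.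
apply/closed_rnormP => l lP; split.
  apply: (closed_rnormP S).1 => // e e0.
  by have [x [Sx _] lx] := lP e e0; exists x.
move=> g Sg; have /closed_submodP[_ _ /closed_rnormP kc] := ker g.
apply: kc => e e0.
by have [x [_ xS] lx] := lP e e0; exists x => //; exact: xS.
Qed.

Lemma regular_projection M : regular_subspace dot J M ->
  exists E : boperator H, [/\ E * E = E, star E = E, (forall x, M (bop E x)),
    (forall s, M s -> bop E s = s) & forall x, Jorth dot J M x -> bop E x = 0].
Proof.
move=> [/closed_submodP[_ ML _] [MT M0 _]].
have [s Ms sM|x|E [EL EM Eid Esym E0]] :=
  hermitian_projection (kreinL J_symmetry) (krein_sym H_hilbert J_symmetry) ML.
- by have : (M `&` Jorth dot J M) s by []; rewrite M0.
- have : [set: H] x by []; rewrite MT => -[s Ms [t tM <-]].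
  by exists s => // g Mg; rewrite addrAC subrr add0r tM.
pose A := mkbop (krein_symmetric_bounded H_hilbert J_symmetry EL Esym).
exists A; split=> //.
  by apply: bop_inj => x; rewrite bopE /= Eid.
exact: bstar_unique.
Qed.

Lemma orthogonal_projection N : closed_subspace N ->
  exists P : boperator H,
    (forall x, N (bop P x)) /\ (forall s, N s -> bop P s = s).
Proof.
move=> cN; have /closed_submodP[_ NL _] := cN.
have dotL a x y z : dot (a *: x + y) z = a * dot x z + dot y z.
  by rewrite linearDl linearZl_LR.
have [s Ms sM|x|E [EL EN Eid Esym _]] :=
  hermitian_projection dotL (@dotC _ _ dot) NL.
- by apply/eqP; rewrite -(dnorm_eq0 dot) sM.
- by have [s Ns xs] := projection_theorem H_hilbert x cN; exists s.
by exists (mkbop (hellinger_toeplitz H_hilbert EL Esym)).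
Qed.

(** The orthogonal projection P onto N need not vanish on M, so the neutral
    summand is built from P (1 - E), which does and is still the identity on
    N, because N is J-orthogonal to M. *)
Lemma Jnormal_projections_nonempty S : pseudo_regular_subspace dot J S ->
  Jnormal_projections dot J S !=set0.
Proof.
move=> [cS [M rM [SE _ _]]]; have /closed_submodP[S0 SL _] := cS.
have cN := closed_isotropic_part cS; set N := isotropic_part dot J S in cN SE.
have /closed_submodP[N0 _ _] := cN.
have MS m : M m -> S m.
  by move=> Mm; rewrite SE; exists 0 => //; exists m => //; rewrite add0r.
have NS n : N n -> S n by case.
have [E [EE sE EM Eid Eort]] := regular_projection rM.
have [P [PN Pid]] := orthogonal_projection cN.
have EN n : N n -> bop E n = 0.
  by move=> [_ nS]; apply: Eort => m Mm; apply: nS; exact: MS.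
have EP : E * P = 0 by apply: bop_inj => x; rewrite bopE EN.
pose p := P * (1 - E).
have pN x : N (bop p x) by exact: PN.
have pid n : N n -> bop p n = n.
  by move=> Nn; rewrite bopE -[bop (1 - E) n]/(n - bop E n) EN // subr0 Pid.
have pp : p * p = p by apply: bop_inj => x; rewrite bopE pid.
have Ep : E * p = 0 by rewrite mulrA EP mul0r.
have pE : p * E = 0 by rewrite -mulrA mulrBl mul1r EE subrr mulr0.
have spp : star p * p = 0.
  apply: bop_inj => x; apply: (krein_inj J_symmetry) => z.
  rewrite bopE -krein_bstar -[bop 0 x]/(0 : H) /krein linear0r.
  by have [_ zS] := pN z; exact: (zS _ (NS _ (pN x))).
pose h := mkbop (@bounded_operator_scale R H 2^-1).
have hC A : h * A = A * h.
  apply: bop_inj => x; rewrite !bopE /=; have := bop_linear A 2^-1 x 0.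
  have A0 : bop A 0 = 0.
    by have := bop_linear A (-1) 0 0; rewrite scaler0 addr0 scaleN1r addNr.
  by rewrite A0 !addr0.
have h2 : h + h = 1.
  apply: bop_inj => x; rewrite bopD /= -scalerDl.
  by rewrite [_ + _](_ : _ = 1) ?scale1r //; field.
have [q [nq qE qp [a qa]]] := normal_idempotent_extend
  (bstarD H_hilbert J_symmetry) (bstarM H_hilbert J_symmetry)
  (bstarK H_hilbert J_symmetry) EE sE pp spp Ep pE hC h2.
exists (bop q); apply/(Jnormal_projectionP H_hilbert J_symmetry).
exists q; split=> //.
apply/seteqP; split=> [_ [x _ <-]|s].
  rewrite qa bopD -[bop E x]scale1r; apply: SL; first exact: MS.
  exact/NS/pN.
rewrite {1}SE => -[n Nn [m Mm <-]]; exists (n + m) => //.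
have q_add x y : bop q (x + y) = bop q x + bop q y.
  by rewrite -{1}[x]scale1r bop_linear scale1r.
by rewrite q_add -{1}(pid _ Nn) -{1}(Eid _ Mm) -!bopE qp qE pid ?Eid.
Qed.

End Existence.

Theorem proposition5p2 (R : realType) (H : completeNormedModType R[i])
    (dot : {dot H for Num.conj}) (J : H -> H) (S : set H)
    (H_hilbert : norm_from_dot dot)
    (H_separable : separable_space H)
    (J_symmetry : symmetry dot J)
    (S_pseudo_regular : pseudo_regular_subspace dot J S) :
  transformation_group (Junitaries_preserving dot J S) /\
  transitive_action_on (Junitaries_preserving dot J S)
    (Jnormal_projections dot J S) (Jconjugation dot J).
Proof.
split; first exact: Junitaries_group.
split; first exact: Jconjugation_action.
- exact: Jnormal_projections_nonempty.
- by move=> Q1 Q2; exact: Junitaries_transitive.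
Qed.
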